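(* Let $R$ be a p.q.-Baer $*$-ring. Then the set of cut vertices of the strong zero-divisor graph $\Gamma^*_s(R)$ forms a complete subgraph of $\Gamma^*_s(R)$, i.e. any two distinct cut vertices of $\Gamma^*_s(R)$ are adjacent.
   Context: A $*$-ring is a ring $R$ with an involution $x\mapsto x^*$ (an additive anti-automorphism of period at most two). A projection is an element $e$ with $e^2=e=e^*$; a central projection is a projection in the centre of $R$. For $S\subseteq R$, $r_R(S)=\{x\in R: sx=0\ \forall s\in S\}$. $R$ is a p.q.-Baer $*$-ring if for every $a\in R$, $r_R(aR)=eR$ for some projection $e\in R$. The strong zero-divisor graph $\Gamma^*_s(R)$ is the simple undirected graph with vertex set $\{0\neq a\in R: r_R(aR)\neq\{0\}\}$, in which distinct vertices $a,b$ are adjacent iff $aRb^*=0$ (i.e. $arb^*=0$ for all $r\in R$). A cut vertex of a graph is a vertex whose removal (with its incident edges) increases the number of connected components. *)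

(* Defs.v *)
From HB Require Import structures.
From Stdlib Require Import Relation_Operators.
From mathcomp Require Import all_boot all_order all_algebra.
From mathcomp Require Import boolp classical_sets functions cardinality.
Set Implicit Arguments.
Unset Strict Implicit.
Unset Printing Implicit Defensive.
Import GRing.Theory.
Local Open Scope classical_set_scope.
Local Open Scope ring_scope.
Local Open Scope card_scope.

(* A unit is part of the structure, but this is no restriction for p.q.-Baer
   *-rings: taking a = 0 in the definition gives R = eR with e a projection,
   so e is a left unit and, applying the involution, a two-sided one. The zero
   ring is allowed. *)
HB.mixin Record PzRing_isStarRing R of GRing.PzRing R := {
  star : R -> R;
  starD : {morph star : x y / x + y};
  starM : {morph star : x y / x * y >-> y * x};
  starK : involutive star
}.

#[short(type="starRingType")]
HB.structure Definition StarRing := {R of GRing.PzRing R & PzRing_isStarRing R}.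

Definition projection (R : starRingType) (e : R) : Prop :=
  e * e = e /\ star e = e.

Definition right_ideal (R : starRingType) (a : R) : set R :=
  [set a * x | x in [set: R]].

Definition rann (R : starRingType) (S : set R) : set R :=
  [set x | forall s, S s -> s * x = 0].

Definition pq_baer (R : starRingType) : Prop :=
  forall a : R, exists2 e : R,
    projection e & rann (right_ideal a) = right_ideal e.

(* Possibly infinite simple undirected graphs with vertices in T. *)
Record sgraph (T : Type) := SGraph {
  vertex : set T;
  adj : T -> T -> Prop;
  adj_vertex : forall x y, adj x y -> vertex x /\ vertex y;
  adj_sym : forall x y, adj x y -> adj y x;
  adj_irr : forall x, ~ adj x x
}.

Section GraphTheory.
Variable T : Type.
Implicit Type G : sgraph T.

Definition connected_in G (x y : T) : Prop := clos_refl_trans T (adj G) x y.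

Definition component G (x : T) : set T :=
  [set y | vertex G y /\ connected_in G x y].

Definition components G : set (set T) := component G @` vertex G.

Definition del_adj G (v x y : T) : Prop := [/\ adj G x y, x <> v & y <> v].

Lemma del_adj_vertex G v x y :
  del_adj G v x y -> (vertex G `\ v) x /\ (vertex G `\ v) y.
Proof. by case=> h xv yv; have [vx vy] := adj_vertex h; split; split. Qed.

Lemma del_adj_sym G v x y : del_adj G v x y -> del_adj G v y x.
Proof. by case=> h xv yv; split=> //; exact: adj_sym. Qed.

Lemma del_adj_irr G v x : ~ del_adj G v x x.
Proof. by case=> h; case: (adj_irr h). Qed.

Definition del_vertex G (v : T) : sgraph T :=
  SGraph (@del_adj_vertex G v) (@del_adj_sym G v) (@del_adj_irr G v).

(* The numbers of components are compared as cardinals, possibly infinite: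
   #components(G) < #components(G - v). *)
Definition cut_vertex G (v : T) : Prop :=
  [/\ vertex G v,
      components G #<= components (del_vertex G v)
    & ~~ (components (del_vertex G v) #<= components G)].

End GraphTheory.

Section StrongZeroDivisorGraph.
Variable R : starRingType.

Definition szd_vertex : set R :=
  [set a | a <> 0 /\ rann (right_ideal a) <> [set 0]].

Definition szd_adj (a b : R) : Prop :=
  [/\ szd_vertex a, szd_vertex b, a <> b & forall r : R, a * r * star b = 0].

Lemma szd_adj_vertex a b : szd_adj a b -> szd_vertex a /\ szd_vertex b.
Proof. by move=> []. Qed.

Lemma szd_adj_sym a b : szd_adj a b -> szd_adj b a.
Proof.
move=> [va vb ab h]; split=> //; first exact: nesym.
have star0 : star (0 : R) = 0.
  by apply: (addIr (star (0 : R))); rewrite -starD !add0r.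
by move=> r; rewrite -star0 -(h (star r)) !starM !starK mulrA.
Qed.

Lemma szd_adj_irr a : ~ szd_adj a a.
Proof. by move=> []. Qed.

Definition strong_zero_divisor_graph : sgraph R :=
  SGraph szd_adj_vertex szd_adj_sym szd_adj_irr.

End StrongZeroDivisorGraph.

(* Main.v *)
(** In a p.q.-Baer *-ring every [a] has a central cover: a central projection
    [e] such that [a * R * x = 0] iff [e * x = 0], so that a nonzero [w] with
    [e * w = 0] is a neighbour of [a].  Let [v] be a cut vertex and let [x], [y],
    with covers [f], [g], lie in different components of the graph without [v].
    If [p := (1 - f) * (1 - g)] is nonzero, every nonzero element of [p * R] is a
    common neighbour of [x] and [y], hence equals [v].  If [p = 0], then for all
    nonzero [w] in [(1 - f) * R] and [u] in [(1 - g) * R] there is a path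
    [x - w - u - y], which must go through [v].  Either way [v] is a central
    projection with [v * R = {0, v}], and for two distinct such elements the
    product is zero. *)

From Stdlib Require Import Relation_Operators.
From mathcomp Require Import all_boot all_algebra.
From mathcomp Require Import boolp classical_sets cardinality.
Require Import Defs.
Set Implicit Arguments.
Unset Strict Implicit.
Unset Printing Implicit Defensive.
Import GRing.Theory.
Local Open Scope classical_set_scope.
Local Open Scope ring_scope.
Local Open Scope card_scope.

(** If all vertices of [G - v] were connected, its components would form an empty set or a
    singleton, which embeds into the components of [G]: there is at least one, that of [v]. *)
Lemma cut_vertex_disconnects (T : Type) (G : sgraph T) (v : T) :
  cut_vertex G v ->
  exists x y, [/\ (vertex G `\ v) x, (vertex G `\ v) y
                & ~ connected_in (del_vertex G v) x y].
Proof.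
case=> vv _ /negP nle; apply: contrapT => hN; apply: nle.
have conn x y : (vertex G `\ v) x -> (vertex G `\ v) y ->
    connected_in (del_vertex G v) x y.
  by move=> vx vy; apply: contrapT => nxy; apply: hN; exists x, y.
have same x y : (vertex G `\ v) x -> (vertex G `\ v) y ->
    component (del_vertex G v) x = component (del_vertex G v) y.
  move=> vx vy; rewrite /component; apply/seteqP.
  by split=> z [vz _]; split=> //; exact: conn.
have [[x0 vx0]|none] := pselect (exists x, (vertex G `\ v) x); last first.
  rewrite (_ : components (del_vertex G v) = set0) ?card_ge0 //.
  by apply/seteqP; split=> // C [x vx _]; case: none; exists x.
apply: card_le_trans (card_image_le
  (fun=> component (del_vertex G v) x0) (components G)).
apply: subset_card_le => _ [x vx <-].
by exists (component G v); [exists v | exact: same].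
Qed.

Section StarRingTheory.
Variable R : starRingType.
Implicit Types a e f v w x y : R.

Lemma star0 : star (0 : R) = 0.
Proof. by apply: (addIr (star (0 : R))); rewrite -starD !add0r. Qed.

Lemma star1 : star (1 : R) = 1.
Proof. by rewrite -[LHS]mul1r -[X in X * _]starK -starM mul1r starK. Qed.

Lemma starN x : star (- x) = - star x.
Proof. by apply: (addIr (star x)); rewrite -starD !addNr star0. Qed.

Definition central_projection e := projection e /\ forall x, e * x = x * e.

Lemma central_projectionC e :
  central_projection e -> central_projection (1 - e).
Proof.
case=> -[ee se] ce; split=> [|x]; last by rewrite mulrBl mulrBr mul1r mulr1 ce.
split; last by rewrite starD starN star1 se.
by rewrite mulrBl mul1r mulrBr mulr1 ee subrr subr0.
Qed.

Lemma central_projectionM e f :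
  central_projection e -> central_projection f -> central_projection (e * f).
Proof.
case=> -[ee se] ce [[ff sf] cf].
split=> [|x]; last by rewrite -mulrA cf mulrA ce mulrA.
split; last by rewrite starM se sf -ce.
by rewrite -mulrA [f * _]mulrA -ce -[e * f * f]mulrA ff mulrA ee.
Qed.

Definition central_cover a e :=
  central_projection e /\ forall x, (forall r, a * r * x = 0) <-> e * x = 0.

(* [rann (right_ideal a)] is a two-sided ideal, so [x * d] lies in [d * R]
   for its generating projection [d]; applying [star] shows [d] central. *)
Lemma central_cover_exists a : pq_baer R -> exists e, central_cover a e.
Proof.
move=> /(_ a)[d [dd sd] hd].
have annP x : (forall r, a * r * x = 0) <-> d * x = x.
  split=> [h|dx r].
    have [] : right_ideal d x by rewrite -hd => _ [r _ <-]; exact: h.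
    by move=> y _ <-; rewrite mulrA dd.
  have : rann (right_ideal a) x by rewrite hd; exists x.
  by apply; exists r.
have dxd x : d * (x * d) = x * d.
  apply/annP => r; rewrite mulrA -[a * r * x]mulrA.
  exact: (annP d).2.
have cd x : d * x = x * d.
  rewrite -[LHS]starK starM sd -(dxd (star x)) !starM starK sd.
  by rewrite -mulrA dxd.
exists (1 - d); split; first by apply: central_projectionC; split.
move=> x; rewrite annP mulrBl mul1r; split=> [->|/eqP]; first by rewrite subrr.
by rewrite subr_eq0 => /eqP.
Qed.

(** Since [e] kills [1 - e], the cover property with [r = 1] yields [a * (1 - e) = 0]. *)
Lemma central_cover_mul a e : central_cover a e -> e * a = a.
Proof.
case=> -[[ee _] ce] /(_ (1 - e))[_ h]; have /h/(_ 1) : e * (1 - e) = 0.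
  by rewrite mulrBr mulr1 ee subrr.
by rewrite mulr1 mulrBr mulr1 -ce => /eqP; rewrite subr_eq0 => /eqP.
Qed.

Lemma central_cover_neq1 a e : szd_vertex a -> central_cover a e -> 1 - e <> 0.
Proof.
move=> [_ ra] [_ he] /eqP; rewrite subr_eq0 => /eqP e1; apply: ra.
apply/seteqP; split=> [x hx|_ -> s _]; last by rewrite mulr0.
have /he : forall r, a * r * x = 0 by move=> r; apply: hx; exists r.
by rewrite -e1 mul1r.
Qed.

(** Centrality turns [f * w = 0] into [w * R * f = 0], so the nonzero [f] makes [w] a vertex; also
    [f * star w = star (w * f) = 0], whence adjacency. *)
Lemma szd_adj_central_cover x w f : szd_vertex x -> central_cover x f ->
  w <> 0 -> f * w = 0 -> szd_adj x w.
Proof.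
move=> vx cx w0 fw; have fx := central_cover_mul cx.
have [[[_ sf] cf] hf] := cx; have x0 := vx.1.
split=> //.
- split=> // rw; have /= : [set 0] f.
    by rewrite -rw => _ [r _ <-]; rewrite -cf mulrA fw mul0r.
  by move=> f0; apply: x0; rewrite -fx f0 mul0r.
- by move=> xw; apply: x0; rewrite -fx xw.
- by apply/hf; rewrite -sf -starM -cf fw star0.
Qed.

(** Centrality brings [e] and [f] together inside [w * r * star u]. *)
Lemma szd_adj_orthogonal e f w u : szd_vertex w -> szd_vertex u ->
  central_projection e -> central_projection f -> e * f = 0 ->
  e * w = w -> f * u = u -> szd_adj w u.
Proof.
move=> vw vu [[_ se] ce] [[_ sf] cf] ef ew fu; split=> //.
  by move=> wu; apply: vw.1; rewrite -ew wu -fu mulrA ef mul0r.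
move=> r; rewrite -ew -fu starM sf -cf -(mulrA e) ce.
by rewrite -mulrA [e * _]mulrA ef mul0r mulr0.
Qed.

Lemma cut_vertex_minimal v :
  pq_baer R -> cut_vertex (strong_zero_divisor_graph R) v ->
  central_projection v /\ forall w, w <> 0 -> v * w = w -> w = v.
Proof.
move=> hR cv; have [x [y [hx hy nxy]]] := cut_vertex_disconnects cv.
have [vx xv] := hx; have [vy yv] := hy.
have [f cxf] := central_cover_exists x hR.
have [g cyg] := central_cover_exists y hR.
have [pf _] := cxf; have [pg _] := cyg.
have pf' := central_projectionC pf; have pg' := central_projectionC pg.
have f'0 := central_cover_neq1 vx cxf; have g'0 := central_cover_neq1 vy cyg.
have ff' : f * (1 - f) = 0 by rewrite mulrBr mulr1 pf.1.1 subrr.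
have gg' : g * (1 - g) = 0 by rewrite mulrBr mulr1 pg.1.1 subrr.
have xadj w : w <> 0 -> (1 - f) * w = w -> szd_adj x w.
  move=> w0 fw; apply: (szd_adj_central_cover vx cxf w0).
  by rewrite -fw mulrA ff' mul0r.
have yadj w : w <> 0 -> (1 - g) * w = w -> szd_adj y w.
  move=> w0 gw; apply: (szd_adj_central_cover vy cyg w0).
  by rewrite -gw mulrA gg' mul0r.
have [p0|p0] := pselect ((1 - f) * (1 - g) = 0).
  have path w u : w <> 0 -> u <> 0 -> (1 - f) * w = w -> (1 - g) * u = u ->
      w <> v -> u = v.
    move=> w0 u0 fw gu wv; apply: contrapT => uv; apply: nxy.
    have xw := xadj _ w0 fw; have yu := yadj _ u0 gu.
    have [_ vw _ _] := xw; have [_ vu _ _] := yu.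
    apply: (rt_trans _ _ _ w); first exact: rt_step.
    apply: (rt_trans _ _ _ u); apply: rt_step; split=> //.
      exact: (szd_adj_orthogonal vw vu pf' pg' p0).
    exact: szd_adj_sym.
  (* The complements are not both [v], else [1 - f = (1 - f) * (1 - g) = 0]. Fixing in [path] one
     that differs from [v] forces every nonzero element below the other to be [v]. *)
  have [fv|fv] := pselect (1 - f = v).
    have gv : 1 - g <> v.
      by move=> gv; apply: f'0; rewrite -pf'.1.1 {2}fv -gv.
    rewrite -fv; split=> // w w0 fw; rewrite fv; apply: contrapT => wv.
    exact: gv (path w _ w0 g'0 fw pg'.1.1 wv).
  have gv := path _ _ f'0 g'0 pf'.1.1 pg'.1.1 fv.
  rewrite -gv; split=> // u u0 gu; rewrite gv.
  exact: (path (1 - f) u f'0 u0 pf'.1.1 gu fv).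
have pp := central_projectionM pf' pg'.
have min w : w <> 0 -> (1 - f) * (1 - g) * w = w -> w = v.
  move=> w0 pw; apply: contrapT => wv; apply: nxy.
  have fw : (1 - f) * w = w by rewrite -pw !mulrA pf'.1.1.
  have gw : (1 - g) * w = w.
    by rewrite -pw !mulrA -pf'.2 -[_ * (1 - g)]mulrA pg'.1.1.
  apply: (rt_trans _ _ _ w); apply: rt_step; split=> //; first exact: xadj.
  by apply: szd_adj_sym; exact: yadj.
(* The nonzero idempotent [(1 - f) * (1 - g)] satisfies the hypotheses of [min] itself, so it equals
   [v]. *)
by have pv := min _ p0 pp.1.1; rewrite pv in pp min *.
Qed.

End StarRingTheory.

Theorem theorem3p8 (R : starRingType) (hR : pq_baer R) (a b : R)
  (ha : cut_vertex (strong_zero_divisor_graph R) a)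
  (hb : cut_vertex (strong_zero_divisor_graph R) b)
  (hab : a <> b) :
  adj (strong_zero_divisor_graph R) a b.
Proof.
have [va _ _] := ha; have [vb _ _] := hb.
have [pa mina] := cut_vertex_minimal hR ha.
have [pb minb] := cut_vertex_minimal hR hb.
apply: (szd_adj_orthogonal va vb pa pb _ pa.1.1 pb.1.1).
(* A nonzero [a * b] would lie in both [a * R] and [b * R], and minimality would give
   [a = a * b = b]. *)
apply: contrapT => ab0; apply: hab.
rewrite -(mina _ ab0) ?mulrA ?pa.1.1 //; apply: minb => //.
by rewrite mulrA -pa.2 -mulrA pb.1.1.
Qed.
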